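(* $IC_{ITRM}\not\subseteq RA_{ITRM}$, i.e. there is a real $x\in{}^{\omega}2$ such that $x$ is totally incompressible, but not $ITRM$-random in the measure sense.
   Context: Reals are elements of ${}^{\omega}2$. An Infinite Time Register Machine ($ITRM$) is a register machine with finitely many registers, each holding a natural number, running an ordinary finite register machine program along ordinal time; at limit times the active program line is the $\liminf$ of the earlier program lines, and each register content is the $\liminf$ of its earlier contents if this is finite, and $0$ otherwise. With an oracle $y \in {}^{\omega}2$, the program may query the bit $y(k)$ for the content $k$ of a register. $P^{y}(n)\downarrow = m$ means that program $P$ with oracle $y$, started with $n$ in the first register and $0$ in all others, halts with $m$ in the first register; $P^{y}\downarrow=m$ means the same with all registers initially $0$. A set $X\subseteq{}^{\omega}2$ is $ITRM$-decidable iff there is an $ITRM$-program $P$ such that, for all $y \in {}^{\omega}2$, $P^{y}\downarrow=1$ if $y\in X$ and $P^{y}\downarrow=0$ if $y\notin X$. A real $x$ is $ITRM$-random in the measure sense iff there is no $ITRM$-decidable set $X$ of Lebesgue measure $0$ with $x\in X$. For $x\in{}^{\omega}2$ and $n\in\omega$, $x_{\setminus n}$ is $x$ with its $n$th bit deleted: $x_{\setminus n}(k)=x(k)$ for $k<n$ and $x_{\setminus n}(k)=x(k+1)$ for $k\ge n$. A real $x$ is $ITRM$-autoreducible iff there is an $ITRM$-program $P$ such that $P^{x_{\setminus n}}(n)\downarrow = x(n)$ for all $n\in\omega$. $x$ is totally incompressible iff it is not $ITRM$-autoreducible. $IC_{ITRM}$ denotes the set of totally incompressible reals and $RA_{ITRM}$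 the set of reals that are $ITRM$-random in the measure sense. *)

(* Defs.v *)
From mathcomp Require Import all_boot all_order all_algebra.
From mathcomp Require Import boolp classical_sets reals ereal topology.
From mathcomp Require Import normedtype sequences.

Set Implicit Arguments.
Unset Strict Implicit.
Unset Printing Implicit Defensive.

Import Order.TTheory GRing.Theory Num.Theory.
Local Open Scope classical_set_scope.

(* Reals in the sense of computability theory: elements of Cantor space. *)
Notation creal := (nat -> bool).

(* Ordinal time is represented by the points of strict well-orderings. *)
Section OrdinalTime.
Variables (T : Type) (lt : T -> T -> Prop).

Definition strict_well_order : Prop :=
  [/\ well_founded lt,
      (forall s t u, lt s t -> lt t u -> lt s u) &
      (forall s t, [\/ lt s t, s = t | lt t s])].

Definition is_zero (t : T) : Prop := forall s, ~ lt s t.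

Definition is_successor (s t : T) : Prop :=
  lt s t /\ ~ (exists u, lt s u /\ lt u t).

Definition is_limit (t : T) : Prop :=
  ~ is_zero t /\ forall s, ~ is_successor s t.

(* v = min { f u | s <= u < t } *)
Definition tail_min (f : T -> nat) (s t : T) (v : nat) : Prop :=
  (exists u, [/\ u = s \/ lt s u, lt u t & f u = v]) /\
  (forall u, u = s \/ lt s u -> lt u t -> (v <= f u)%N).

(* liminf_{u < t} f u exists as a natural number and equals m:
   m = max_{s < t} min_{s <= u < t} f u. *)
Definition finite_liminf (f : T -> nat) (t : T) (m : nat) : Prop :=
  (exists s, lt s t /\ tail_min f s t m) /\
  (forall s v, lt s t -> tail_min f s t v -> (v <= m)%N).

End OrdinalTime.

(* Instructions for a machine with registers R_0, ..., R_k. *)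
Inductive instr (k : nat) : Type :=
| Zero of 'I_k.+1                     (* R_i := 0 *)
| Succ of 'I_k.+1                     (* R_i := R_i + 1 *)
| Copy of 'I_k.+1 & 'I_k.+1           (* R_i := R_j *)
| JumpEq of 'I_k.+1 & 'I_k.+1 & nat   (* if R_i = R_j go to line q *)
| Oracle of 'I_k.+1.                  (* R_i := y(R_i), y the oracle *)

Record program : Type := Program {
  last_reg : nat;
  code : seq (instr last_reg)
}.

Record config (k : nat) : Type := Config {
  line : nat;
  regs : {ffun 'I_k.+1 -> nat}
}.

Definition set_reg (k : nat) (r : {ffun 'I_k.+1 -> nat}) (i : 'I_k.+1)
    (v : nat) : {ffun 'I_k.+1 -> nat} :=
  [ffun j => if j == i then v else r j].

Definition exec (k : nat) (y : creal) (I : instr k) (c : config k) : config k :=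
  let l := line c in
  let r := regs c in
  match I with
  | Zero i => Config l.+1 (set_reg r i 0)
  | Succ i => Config l.+1 (set_reg r i (r i).+1)
  | Copy i j => Config l.+1 (set_reg r i (r j))
  | JumpEq i j q => Config (if r i == r j then q else l.+1) r
  | Oracle i => Config l.+1 (set_reg r i (nat_of_bool (y (r i))))
  end.

(* The machine halts, step = None, when the active line is not in the program. *)
Definition step (P : program) (y : creal) (c : config (last_reg P)) :
    option (config (last_reg P)) :=
  omap (fun I => exec y I c) (onth (code P) (line c)).

Definition init (P : program) (n : nat) : config (last_reg P) :=
  Config 0 [ffun i => if i == ord0 then n else 0].

(* c is the run of P with oracle y on input n along the well-ordering lt; by the
   successor clause a halting configuration can only occur at the last point. *)
Definition is_run (P : program) (y : creal) (n : nat) (T : Type)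
    (lt : T -> T -> Prop) (c : T -> config (last_reg P)) : Prop :=
  [/\ forall t, is_zero lt t -> c t = init P n,
      forall s t, is_successor lt s t -> step y (c s) = Some (c t) &
      forall t, is_limit lt t ->
        finite_liminf lt (fun u => line (c u)) t (line (c t)) /\
        forall i,
          finite_liminf lt (fun u => regs (c u) i) t (regs (c t) i) \/
          (forall m, ~ finite_liminf lt (fun u => regs (c u) i) t m) /\
          regs (c t) i = 0].

(* P^y(n) halts with output m. *)
Definition computes (P : program) (y : creal) (n m : nat) : Prop :=
  exists (T : Type) (lt : T -> T -> Prop) (c : T -> config (last_reg P)) (t : T),
    [/\ strict_well_order lt, is_run y n lt c,
        step y (c t) = None & regs (c t) ord0 = m].

Definition ITRM_decidable (X : set creal) : Prop :=
  exists P : program, forall y : creal,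
    (X y -> computes P y 0 1) /\ (~ X y -> computes P y 0 0).

Definition cylinder (s : seq bool) : set creal :=
  [set x | forall i, (i < size s)%N -> x i = nth false s i].

(* Outer Lebesgue (fair coin) measure on Cantor space, the cylinder of s having
   measure 2^-(size s).  The sets of outer measure 0 are exactly the (measurable)
   sets of Lebesgue measure 0. *)
Definition outer_lebesgue (R : realType) (X : set creal) : \bar R :=
  ereal_inf [set (\sum_(0 <= k <oo) ((2%:R^-1 : R) ^+ size (s k))%R%:E)%E |
             s in [set s : nat -> seq bool |
                   X `<=` \bigcup_k cylinder (s k)]].

Definition RA_ITRM (R : realType) : set creal :=
  [set x | ~ exists X : set creal,
     [/\ ITRM_decidable X, outer_lebesgue R X = 0%E & X x]].

Definition delete_bit (n : nat) (x : creal) : creal :=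
  fun k => if (k < n)%N then x k else x k.+1.

Definition ITRM_autoreducible (x : creal) : Prop :=
  exists P : program, forall n : nat,
    computes P (delete_bit n x) n (nat_of_bool (x n)).

Definition IC_ITRM : set creal := [set x | ~ ITRM_autoreducible x].

(* Main.v *)
From mathcomp Require Import all_boot all_order all_algebra zify lra.
From mathcomp Require Import boolp classical_sets reals ereal topology.
From mathcomp Require Import normedtype sequences wochoice.
Require Import Defs.

(**
  The witness is a sufficiently Cohen generic real z, spread over the even
  positions, with 0 at the odd positions.  The reals that vanish at the odd
  positions form a null set ([even_supported_null]), and a machine decides this
  set by reading the odd bits one after the other until its counter overflows
  ([even_supported_decidable]).  So the witness is not random.

  A program that autoreduces the witness predicts every bit z(j) from the other
  bits.  If the set of z on which all its predictions are correct has the Baire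
  property, it is meager: otherwise finitely many bits of z would force all
  predictions to be correct; but flipping a later bit respects these finitely
  many bits, changes the bit to be predicted, and does not change its
  prediction ([meager_autoreduces]).  As there are countably many programs, the
  Baire category theorem then gives a z such that none of them autoreduces the
  witness.

  What needs proof is that, up to meager sets, the result of a computation
  depends on its oracle in a way that has the Baire property
  ([generic_evaluation]).  The Baire property is used in the form that every
  condition has an extension forcing the set or its complement ([decided]).  At
  each fixed countable time it follows by transfinite induction, since limits
  involve only countable unions and intersections ([decided_run]).  But the
  halting times of different oracles could be unbounded in the countable
  ordinals.  They are bounded on generic oracles: there are only countably many
  events of the form that a condition forces a component of the machine to be
  below a number, so beyond a countable time d0 each event that occurs at all
  occurs cofinally often, and there are countable limits d1 < d2 beyond d0 below
  which all these events recur.  At both limits each component takes the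
  minimum of its values from d0 on; so a generic run has the same configuration
  at d1 and at d2 and nothing falls below it in between ([generic_loop]).  Such
  a run repeats this loop forever or has halted by d1 ([loop_result]), and
  its result can be read off at time d1.

  In the definition of halting, time is an arbitrary well-ordering, which may be
  longer than every countable ordinal.  Runs along different well-orderings are
  compared through isomorphisms of segments, above arbitrary base points so that
  the turns of a loop can be compared with each other ([isoseg_agree]).
*)

Set Implicit Arguments.
Unset Strict Implicit.
Unset Printing Implicit Defensive.

(** * Category in Cantor space *)

Definition extends (s t : seq bool) : Prop :=
  (size s <= size t)%N /\ cylinder s (nth false t).

Definition nowhere_dense (N : creal -> Prop) : Prop :=
  forall s, exists t, extends s t /\ forall x, cylinder t x -> ~ N x.

Definition meager (M : creal -> Prop) : Prop :=
  exists N : nat -> creal -> Prop,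
    (forall k, nowhere_dense (N k)) /\ (forall x, M x -> exists k, N k x).

Definition forces (s : seq bool) (B : creal -> Prop) : Prop :=
  meager (fun x => cylinder s x /\ ~ B x).

(** The Baire property, formulated through forcing: the conditions that decide
    whether the generic point belongs to B are dense. *)
Definition decided (B : creal -> Prop) : Prop :=
  forall s, exists t, extends s t /\ (forces t B \/ forces t (fun x => ~ B x)).

Lemma extends_refl s : extends s s.
Proof. by split. Qed.

Lemma extends_trans s t u : extends s t -> extends t u -> extends s u.
Proof.
move=> [st Hst] [tu Htu]; split=> [|i is_]; first exact: leq_trans tu.
by rewrite Htu ?Hst // (leq_trans is_).
Qed.

Lemma cylinder_extends s t x : extends s t -> cylinder t x -> cylinder s x.
Proof. by move=> [st Hst] Hx i is_; rewrite Hx ?Hst // (leq_trans is_). Qed.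

Lemma extends_cat s r : extends s (s ++ r).
Proof. by split=> [|i is_]; rewrite ?size_cat ?leq_addr // nth_cat is_. Qed.

Lemma sub_meager (A B : creal -> Prop) :
  (forall x, A x -> B x) -> meager B -> meager A.
Proof. by move=> AB [N [hN BN]]; exists N; split=> // x /AB/BN. Qed.

Lemma meager_ex (I : countType) (M : I -> creal -> Prop) :
  (forall i, meager (M i)) -> meager (fun x => exists i, M i x).
Proof.
move=> /choice[N hN].
exists (fun n x => if unpickle n is Some (i, k) then N i k x else False); split.
  move=> n; case: (unpickle n) => [a|]; first by case: a => i k; apply: (hN i).1.
  by move=> s; exists s; split=> [|x _ []]; apply: extends_refl.
by move=> x [i /(hN i).2[k Nx]]; exists (pickle (i, k)); rewrite pickleK.
Qed.

Lemma meager0 : meager (fun _ => False).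
Proof.
exists (fun _ _ => False); split=> // _ s; exists s.
by split=> [|x _ []]; apply: extends_refl.
Qed.

Lemma meagerU (A B : creal -> Prop) :
  meager A -> meager B -> meager (fun x => A x \/ B x).
Proof.
move=> mA mB; have h (b : bool) : meager (if b then A else B) by case: b.
apply: sub_meager (meager_ex h).
by move=> x [|] Hx; [exists true|exists false].
Qed.

Lemma nowhere_dense_meager (N : creal -> Prop) : nowhere_dense N -> meager N.
Proof. by move=> hN; exists (fun _ => N); split=> // x; exists 0. Qed.

(** The Baire category theorem: the extensions avoiding the nowhere dense sets
    one after the other converge to a point. *)
Lemma baire_cylinder (M : creal -> Prop) s :
  meager M -> exists x, cylinder s x /\ ~ M x.
Proof.
move=> [N [hN MN]].
have /choice[F' hF'] (q : nat * seq bool) := hN q.1 q.2.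
pose F k t := F' (k, t); have hF k t := hF' (k, t).
pose t := fix t k := if k is k'.+1 then F k' (rcons (t k') false) else s.
have tS k : extends (t k) (t k.+1).
  by have [/= h _] := hF k (rcons (t k) false); apply: extends_trans h;
     rewrite -cats1; apply: extends_cat.
have tle k l : (k <= l)%N -> extends (t k) (t l).
  elim: l => [|l IH]; first by rewrite leqn0 => /eqP->; apply: extends_refl.
  rewrite leq_eqVlt => /predU1P[->|/IH h]; first exact: extends_refl.
  exact: extends_trans h (tS l).
have tsize k : (k <= size (t k))%N.
  elim: k => // k IH; have [[/= h _] _] := hF k (rcons (t k) false).
  by apply: leq_trans h; rewrite size_rcons.
pose x i := nth false (t i.+1) i.
have tx k : cylinder (t k) x.
  move=> i ik; rewrite /x.
  have [_ <-] := tle _ _ (leq_maxl k i.+1) => //.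
  by have [_ ->] := tle _ _ (leq_maxr k i.+1).
exists x; split; first exact: (tx 0).
by move=> /MN[k]; apply: (hF k (rcons (t k) false)).2; apply: (tx k.+1).
Qed.

(** A set that is locally meager below a dense set of conditions is meager: the
    conditions are countable, and what they leave uncovered is nowhere dense. *)
Lemma locally_meager (M : creal -> Prop) :
  (forall s, exists t, extends s t /\ meager (fun x => cylinder t x /\ M x)) ->
  meager M.
Proof.
move=> h; pose D t := meager (fun x => cylinder t x /\ M x).
apply: (@sub_meager _ (fun x => (~ exists t, D t /\ cylinder t x) \/
    exists t, D t /\ cylinder t x /\ M x)).
  move=> x Mx; have [[t [Dt tx]]|] := EM (exists t, D t /\ cylinder t x).
    by right; exists t.
  by left.
apply: meagerU.
  apply: nowhere_dense_meager => s; have [t [st Dt]] := h s.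
  by exists t; split=> // x tx; apply; exists t.
apply: meager_ex => t; have [Dt|nDt] := EM (D t).
  by apply: sub_meager Dt => x [].
by apply: sub_meager meager0 => x [].
Qed.

Lemma sub_forces s (A B : creal -> Prop) :
  (forall x, A x -> B x) -> forces s A -> forces s B.
Proof. by move=> AB; apply: sub_meager => x [sx nB]; split=> // /AB. Qed.

Lemma eq_decided (A B : creal -> Prop) :
  (forall x, A x <-> B x) -> decided A -> decided B.
Proof.
move=> AB hA s; have [t [st h]] := hA s; exists t; split=> //.
by case: h => h; [left|right]; apply: sub_forces h => x; case: (AB x); tauto.
Qed.

Lemma decided_not B : decided B -> decided (fun x => ~ B x).
Proof.
move=> hB s; have [t [st h]] := hB s; exists t; split=> //.
case: h => h; [right|by left].
by apply: sub_forces h => x Bx; apply.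
Qed.

(** Below a condition none of whose extensions forces any of the sets, each of
    the sets is locally meager, hence so is their union. *)
Lemma decided_ex (I : countType) (B : I -> creal -> Prop) :
  (forall i, decided (B i)) -> decided (fun x => exists i, B i x).
Proof.
move=> hB s.
have [[t [st [i ti]]]|none] := EM (exists t, extends s t /\ exists i, forces t (B i)).
  by exists t; split=> //; left; apply: sub_forces ti => x; exists i.
exists s; split; [exact: extends_refl|right].
apply: (@sub_meager _ (fun x => exists i, cylinder s x /\ B i x)).
  by move=> x [sx /contrapT[i Bx]]; exists i.
apply: meager_ex => i; apply: locally_meager => t.
(* Conditions t incompatible with s are harmless; compatible ones get a common
   extension u. *)
have [[x [tx sx]]|disj] := EM (exists x, cylinder t x /\ cylinder s x); last first.
  exists t; split; first exact: extends_refl.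
  by apply: sub_meager meager0 => x [tx [sx _]]; apply: disj; exists x.
pose u := mkseq x (maxn (size s) (size t)).
have [v [uv h]] := hB i u.
have su : extends s u.
  split=> [|k ks]; first by rewrite size_mkseq leq_maxl.
  by rewrite nth_mkseq ?sx // (leq_trans ks) ?leq_maxl.
have tu : extends t u.
  split=> [|k ks]; first by rewrite size_mkseq leq_maxr.
  by rewrite nth_mkseq ?tx // (leq_trans ks) ?leq_maxr.
exists v; split; first exact: extends_trans uv.
case: h => h.
  by case: none; exists v; split; [exact: extends_trans su uv|exists i].
by apply: sub_meager h => z [vz [_ Bz]]; split=> //; apply.
Qed.

Lemma decided_const (Q : Prop) : decided (fun _ => Q).
Proof.
move=> s; exists s; split; first exact: extends_refl.
by have [q|q] := EM Q; [left|right]; apply: sub_meager meager0 => x [].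
Qed.

Lemma decided_or (A B : creal -> Prop) :
  decided A -> decided B -> decided (fun x => A x \/ B x).
Proof.
move=> hA hB; have h (b : bool) : decided (if b then A else B) by case: b.
apply: eq_decided (decided_ex h).
by move=> x; split=> [[[]]|[]] Hx; [left|right|exists true|exists false].
Qed.

Lemma decided_and (A B : creal -> Prop) :
  decided A -> decided B -> decided (fun x => A x /\ B x).
Proof.
move=> hA hB; apply: eq_decided (decided_not (decided_or (decided_not hA)
  (decided_not hB))) => x.
by have [] := EM (A x); have [] := EM (B x); tauto.
Qed.

Lemma decided_all (I : countType) (B : I -> creal -> Prop) :
  (forall i, decided (B i)) -> decided (fun x => forall i, B i x).
Proof.
move=> hB; apply: eq_decided (decided_not (decided_ex
  (fun i => decided_not (hB i)))) => x.
split=> [h i|h [i]]; last exact.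
by apply: contrapT => nB; apply: h; exists i.
Qed.

Lemma decided_bit k b : decided (fun x => x k = b).
Proof.
move=> s; pose t := s ++ nseq k.+1 false.
have kt : (k < size t)%N by rewrite size_cat size_nseq ltn_addl.
exists t; split; first exact: extends_cat.
have [e|e] := EM (nth false t k = b); [left|right];
  apply: sub_meager meager0 => x [tx]; rewrite tx //; exact.
Qed.

(** A set that is chosen among countably many decided sets by a function with
    decided values is again decided; oracle queries are of this form. *)
Lemma decided_bind (X : countType) (f : creal -> X) (B : X -> creal -> Prop) :
  (forall v, decided (fun x => f x = v)) -> (forall v, decided (B v)) ->
  decided (fun x => B (f x) x).
Proof.
move=> hf hB; have h v := decided_and (hf v) (hB v).
by apply: eq_decided (decided_ex h) => x; split=> [[v [<-]]|Bx] //; exists (f x).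
Qed.

(** Truth is forced: generically, a decided set contains only points that are
    put into it by one of their finite initial segments. *)
Lemma decided_forced B :
  decided B -> meager (fun x => B x /\ ~ exists s, cylinder s x /\ forces s B).
Proof.
move=> hB; apply: locally_meager => s; have [t [st h]] := hB s.
exists t; split=> //; case: h => h.
  by apply: sub_meager meager0 => x [tx [_]]; apply; exists t.
by apply: sub_meager h => x [tx [Bx _]]; split=> //; apply.
Qed.

Lemma nowhere_forced_meager B :
  decided B -> (forall s, ~ forces s B) -> meager B.
Proof.
move=> hB h; apply: sub_meager (decided_forced hB) => x Bx; split=> //.
by case=> s [_ /h].
Qed.

Definition flip (n : nat) (x : creal) : creal := fun i => (i == n) (+) x i.

Definition flip_seq (n : nat) (s : seq bool) := mkseq (flip n (nth false s)) (size s).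

Lemma cylinder_flip n s x : cylinder (flip_seq n s) x <-> cylinder s (flip n x).
Proof.
split=> h i; rewrite ?size_mkseq => is_.
  by rewrite /flip h ?size_mkseq // nth_mkseq // addbA addbb.
by rewrite nth_mkseq // /flip -(h i is_) addbA addbb.
Qed.

Lemma flip_seqK n : involutive (flip_seq n).
Proof.
move=> s; apply: (@eq_from_nth _ false); rewrite !size_mkseq // => i is_.
by rewrite !nth_mkseq ?size_mkseq // /flip nth_mkseq // addbA addbb.
Qed.

Lemma extends_flip n s t : extends s t -> extends (flip_seq n s) (flip_seq n t).
Proof.
move=> [st h]; split=> [|i]; rewrite !size_mkseq // => is_.
by rewrite !nth_mkseq ?(leq_trans is_) // /flip h.
Qed.

Lemma meager_flip n (M : creal -> Prop) : meager M -> meager (fun x => M (flip n x)).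
Proof.
move=> [N [hN MN]]; exists (fun k x => N k (flip n x)); split=> [k s|x /MN] //.
have [t [st h]] := hN k (flip_seq n s).
exists (flip_seq n t); split; first by rewrite -[s](flip_seqK n); apply: extends_flip.
by move=> x /cylinder_flip/h.
Qed.

(** * Deterministic runs along well-orderings *)

Section WellOrder.
Variables (T : Type) (lt : T -> T -> Prop).
Hypothesis lt_wo : strict_well_order lt.

Definition le (s t : T) : Prop := t = s \/ lt s t.

Lemma swo_wf : well_founded lt. Proof. by case: lt_wo. Qed.

Lemma swo_trans s t u : lt s t -> lt t u -> lt s u.
Proof. by case: lt_wo => _ h _; apply: h. Qed.

Lemma swo_irr s : ~ lt s s.
Proof. by elim/(well_founded_ind swo_wf): s => s IH h; apply: IH (h) h. Qed.

Lemma swo_le_lt_trans s t u : le s t -> lt t u -> lt s u.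
Proof. by case=> [->//|]; apply: swo_trans. Qed.

Lemma swo_lt_le_trans s t u : lt s t -> le t u -> lt s u.
Proof. by move=> h [->//|]; apply: swo_trans. Qed.

Lemma swo_le_trans s t u : le s t -> le t u -> le s u.
Proof. by move=> h [->//|h']; right; apply: swo_le_lt_trans h'. Qed.

Lemma swo_le_total s t : le s t \/ lt t s.
Proof. by case: lt_wo => _ _ /(_ s t)[]; [left; right|left; left|right]. Qed.

Lemma swo_lt_geF s t : lt s t -> ~ le t s.
Proof. by move=> h h'; apply: (@swo_irr s); apply: swo_lt_le_trans h h'. Qed.

Lemma swo_le_anti s t : le s t -> le t s -> s = t.
Proof. by case=> // h /(swo_lt_geF h). Qed.

Lemma swo_min (Q : T -> Prop) :
  (exists t, Q t) -> exists t, Q t /\ forall s, Q s -> le t s.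
Proof.
move=> [t]; elim/(well_founded_ind swo_wf): t => t IH Qt.
have [[s [st Qs]]|h] := EM (exists s, lt s t /\ Q s); first exact: IH st Qs.
by exists t; split=> // s Qs; case: (swo_le_total t s) => // st; case: h; exists s.
Qed.

Lemma swo_max s t : exists u, [/\ le s u, le t u & u = s \/ u = t].
Proof.
case: (swo_le_total s t) => h; [exists t|exists s]; split; rewrite /le; tauto.
Qed.

(** The supremum, stated so that it also serves when it is not attained: it is
    then a limit of points of Q. *)
Lemma swo_sup (Q : T -> Prop) b : (exists t, Q t) -> (forall t, Q t -> le t b) ->
  exists u, [/\ le u b, forall t, Q t -> le t u &
    forall s, lt s u -> exists t, Q t /\ lt s t].
Proof.
move=> Q0 Qb.
have [u [uQ umin]] := @swo_min (fun u => forall t, Q t -> le t u) (ex_intro _ b Qb).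
exists u; split=> // [|s su]; first exact: umin.
apply: contrapT => h; apply: (swo_lt_geF su); apply: umin => t Qt.
by case: (swo_le_total t s) => // st; case: h; exists t.
Qed.

Lemma swo_succ_le s t u : is_successor lt s t -> lt u t -> le u s.
Proof.
by move=> [st h] ut; case: (swo_le_total u s) => // su; case: h; exists u.
Qed.

Lemma swo_succ_inj s s' t : is_successor lt s t -> is_successor lt s' t -> s = s'.
Proof.
by move=> h h'; apply: swo_le_anti; [apply: swo_succ_le h' h.1|apply: swo_succ_le h h'.1].
Qed.

(** The condition of [finite_liminf] without its minima over intervals, which makes
    it a combination of conditions on single values of f. *)
Definition liminf_at (f : T -> nat) (t : T) (m : nat) : Prop :=
  (exists s, lt s t /\ forall u, le s u -> lt u t -> (m <= f u)%N) /\
  (forall s, lt s t -> exists u, [/\ le s u, lt u t & (f u <= m)%N]).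

Lemma liminf_atP f t m : finite_liminf lt f t m <-> liminf_at f t m.
Proof.
split=> [[[s0 [s0t [_ s0m]]] h]|[[s [st hs]] h]].
  split=> [|s st]; first by exists s0.
  have [r [sr s0r rE]] := swo_max s s0.
  have rt : lt r t by case: rE => ->.
  pose Q v := `[< exists u, [/\ le r u, lt u t & f u = v] >].
  have Q0 : exists v, Q v by exists (f r); apply/asboolP; exists r; split=> //; left.
  case: (ex_minnP Q0) => v /asboolP[u [ru ut fu]] vmin.
  have vm : (v <= m)%N.
    apply: (h r) => //; split=> [|w rw wt]; first by exists u.
    by apply: vmin; apply/asboolP; exists w.
  by exists u; split=> //; [apply: swo_le_trans sr ru|rewrite fu].
split.
  exists s; split=> //; split=> [|u su ut]; last exact: hs.
  have [u [su ut fu]] := h s st; exists u; split=> //.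
  by apply/eqP; rewrite eqn_leq fu hs.
move=> r v rt [_ hv]; have [u [ru ut fu]] := h r rt.
exact: leq_trans (hv _ ru ut) fu.
Qed.

Lemma liminf_at_le f t m m' : liminf_at f t m -> liminf_at f t m' -> (m <= m')%N.
Proof.
move=> [[s [st hs]] _] [_ h']; have [u [su ut fu]] := h' s st.
exact: leq_trans (hs _ su ut) fu.
Qed.

Lemma liminf_at_inj f t m m' : liminf_at f t m -> liminf_at f t m' -> m = m'.
Proof. by move=> h h'; apply/eqP; rewrite eqn_leq !(@liminf_at_le f t). Qed.

Lemma eq_liminf_at f g t m : (forall u, lt u t -> f u = g u) ->
  liminf_at f t m -> liminf_at g t m.
Proof.
move=> fg [[s [st hs]] h]; split.
  by exists s; split=> // u su ut; rewrite -fg //; apply: hs.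
by move=> r /h[u [ru ut fu]]; exists u; split=> //; rewrite -fg.
Qed.

Definition limval_at (f : T -> nat) (t : T) (v : nat) : Prop :=
  liminf_at f t v \/ (forall m, ~ liminf_at f t m) /\ v = 0.

Lemma limval_at_ex f t : exists v, limval_at f t v.
Proof.
have [[m h]|h] := EM (exists m, liminf_at f t m); first by exists m; left.
by exists 0; right; split=> // m hm; apply: h; exists m.
Qed.

Lemma limval_at_inj f t v v' : limval_at f t v -> limval_at f t v' -> v = v'.
Proof.
case=> [h|[h ->]] [h'|[h' ->]] //; [exact: liminf_at_inj h h'|by case: (h' v)|].
by case: (h v').
Qed.

End WellOrder.

Definition component k (j : option 'I_k.+1) (c : config k) : nat :=
  if j is Some i then regs c i else line c.

Lemma eq_component k (c d : config k) :
  (forall j, component j c = component j d) -> c = d.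
Proof.
case: c d => [l r] [l' r'] h; have /= -> := h None.
by congr Config; apply/ffunP => i; apply: (h (Some i)).
Qed.

(** A halted machine stays where it is, so that runs can be continued forever. *)
Definition stutter P y (c : config (last_reg P)) := odflt c (step y c).

Section Follows.
Variables (T : Type) (lt : T -> T -> Prop) (P : program) (y : creal).
Variable c : T -> config (last_reg P).
Hypothesis lt_wo : strict_well_order lt.

(** The successor and limit clauses of a run in one deterministic condition, which
    makes sense after halting too and does not mention the initial configuration,
    so that it applies to a run cut off at any base point. *)
Definition follows (t : T) : Prop :=
  (forall s, is_successor lt s t -> c t = stutter y (c s)) /\
  ((forall s, ~ is_successor lt s t) ->
    forall j, limval_at lt (fun u => component j (c u)) t (component j (c t))).

Lemma halted_forever a b : (forall t, lt a t -> follows t) ->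
  step y (c a) = None -> le lt a b -> c b = c a.
Proof.
move=> hc ha; elim/(well_founded_ind (swo_wf lt_wo)): b => b IH [->//|ab].
have [hs hl] := hc b ab.
have [[s sb]|nos] := EM (exists s, is_successor lt s b).
  have as_ := swo_succ_le lt_wo sb ab.
  by rewrite (hs s sb) (IH s sb.1 as_) /stutter ha.
apply: eq_component => j; apply: limval_at_inj (hl _ j) _.
  by move=> s sb; apply: nos; exists s.
left; split.
  by exists a; split=> // u au ub; rewrite (IH u).
move=> s sb; have [r [sr ar rE]] := swo_max lt_wo s a.
have rb : lt r b by case: rE => ->.
by exists r; split=> //; rewrite (IH r).
Qed.

End Follows.

Lemma run_follows P y n T lt (c : T -> config (last_reg P)) t :
  strict_well_order lt -> is_run y n lt c -> ~ is_zero lt t -> follows lt y c t.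
Proof.
move=> wo [_ hs hl] t0; split=> [s st|nos j]; first by rewrite /stutter (hs s t st).
have [hline hregs] := hl t (conj t0 nos).
case: j => [i|] /=; last by left; apply/liminf_atP.
case: (hregs i) => [h|[h ->]]; first by left; apply/liminf_atP.
by right; split=> // m hm; apply: (h m); apply/liminf_atP.
Qed.

(** Isomorphism of the segments from e to a and from e' to b, as the back-and-forth
    relation; for well-orderings the isomorphism is unique, so no map is needed. *)
Section Isoseg.
Variables (A : Type) (ltA : A -> A -> Prop) (B : Type) (ltB : B -> B -> Prop).
Hypotheses (woA : strict_well_order ltA) (woB : strict_well_order ltB).
Variables (e : A) (e' : B).

Inductive isoseg (a : A) (b : B) : Prop := Isoseg of
  (forall a', le ltA e a' -> ltA a' a ->
     exists b', [/\ le ltB e' b', ltB b' b & isoseg a' b']) &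
  (forall b', le ltB e' b' -> ltB b' b ->
     exists a', [/\ le ltA e a', ltA a' a & isoseg a' b']).

Lemma isoseg_forth a b a' : isoseg a b -> le ltA e a' -> ltA a' a ->
  exists b', [/\ le ltB e' b', ltB b' b & isoseg a' b'].
Proof. by case=> h _; apply: h. Qed.

Lemma isoseg_back a b b' : isoseg a b -> le ltB e' b' -> ltB b' b ->
  exists a', [/\ le ltA e a', ltA a' a & isoseg a' b'].
Proof. by case=> _ h; apply: h. Qed.

Lemma isoseg_total a b : le ltA e a -> le ltB e' b ->
  [\/ exists a', [/\ le ltA e a', ltA a' a & isoseg a' b],
      exists b', [/\ le ltB e' b', ltB b' b & isoseg a b'] | isoseg a b].
Proof.
elim/(well_founded_ind (swo_wf woA)): a b => a IHa b.
elim/(well_founded_ind (swo_wf woB)): b => b IHb ea eb.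
have [h1|n1] := EM (exists a', [/\ le ltA e a', ltA a' a & isoseg a' b]).
  by constructor 1.
have [h2|n2] := EM (exists b', [/\ le ltB e' b', ltB b' b & isoseg a b']).
  by constructor 2.
constructor 3; constructor.
  move=> a' ea' a'a; case: (IHa a' a'a b ea' eb) => //.
    move=> [a2 [h a2a' h']]; case: n1; exists a2; split=> //.
    exact: swo_trans a2a' a'a.
  by move=> h; case: n1; exists a'.
move=> b' eb' b'b; case: (IHb b' b'b ea eb') => //.
  move=> [b2 [h b2b' h']]; case: n2; exists b2; split=> //.
  exact: swo_trans b2b' b'b.
by move=> h; case: n2; exists b'.
Qed.

Lemma isoseg_injr a b b' : le ltA e a -> le ltB e' b -> le ltB e' b' ->
  isoseg a b -> isoseg a b' -> b = b'.
Proof.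
elim/(well_founded_ind (swo_wf woA)): a b b' => a IH.
suff lt_absurd b b' : le ltA e a -> le ltB e' b -> isoseg a b -> isoseg a b' -> ~ ltB b b'.
  move=> b b' ea eb eb' ab ab'; case: (swo_le_total woB b b').
    by case=> // /(lt_absurd _ _ ea eb ab ab').
  by move/(lt_absurd _ _ ea eb' ab' ab).
move=> ea eb ab ab' bb'.
have [a1 [ea1 a1a a1b]] := isoseg_back ab' eb bb'.
have [b1 [eb1 b1b a1b1]] := isoseg_forth ab ea1 a1a.
by apply: (@swo_irr _ _ woB b); rewrite {1}(IH a1 a1a b b1).
Qed.

Lemma isoseg_lt a b a' b' : le ltA e a -> le ltB e' b -> isoseg a b ->
  le ltA e a' -> le ltB e' b' -> isoseg a' b' -> ltA a a' -> ltB b b'.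
Proof.
move=> ea eb ab ea' eb' a'b' aa'.
have [b1 [eb1 b1b ab1]] := isoseg_forth a'b' ea aa'.
by rewrite (isoseg_injr ea eb eb1 ab ab1).
Qed.

Lemma isoseg_base a b : isoseg a b -> le ltA e a -> le ltB e' b -> a = e -> b = e'.
Proof.
move=> ab ea [->//|e'b] ae; subst a.
have [a' [ea' /(swo_lt_geF woA)]] := isoseg_back ab (or_introl erefl) e'b.
by move/(_ ea').
Qed.
End Isoseg.

Lemma isoseg_sym A (ltA : A -> A -> Prop) B (ltB : B -> B -> Prop) e e' a b :
  strict_well_order ltA -> isoseg ltA ltB e e' a b -> isoseg ltB ltA e' e b a.
Proof.
move=> wo; elim/(well_founded_ind (swo_wf wo)): a b => a IH b ab; constructor.
  move=> b' eb' bb'; have [a' [h1 h2 h3]] := isoseg_back ab eb' bb'.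
  by exists a'; split=> //; apply: IH.
move=> a' ea' aa'; have [b' [h1 h2 h3]] := isoseg_forth ab ea' aa'.
by exists b'; split=> //; apply: IH.
Qed.

Section Agreement.
Variables (A : Type) (ltA : A -> A -> Prop) (B : Type) (ltB : B -> B -> Prop).
Hypotheses (woA : strict_well_order ltA) (woB : strict_well_order ltB).

Lemma isoseg_successor e e' a b s s' : le ltA e s -> le ltB e' s' ->
  isoseg ltA ltB e e' a b -> isoseg ltA ltB e e' s s' ->
  le ltA e a -> le ltB e' b ->
  is_successor ltA s a -> is_successor ltB s' b.
Proof.
move=> es es' ab ss' ea eb [sa h].
split; first exact: (isoseg_lt woA woB es es' ss' ea eb ab sa).
move=> [u' [s'u' u'b]].
have eu' : le ltB e' u' by right; apply: swo_le_lt_trans woB _ _ _ es' s'u'.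
have [u [eu ua uu']] := isoseg_back ab eu' u'b.
apply: h; exists u; split=> //.
apply: (isoseg_lt woB woA es' es (isoseg_sym woA ss') eu' eu
  (isoseg_sym woA uu') s'u').
Qed.

Lemma isoseg_liminf e e' a b f g m :
  (forall u u', le ltA e u -> le ltB e' u' -> ltA u a -> isoseg ltA ltB e e' u u' ->
     f u = g u') ->
  isoseg ltA ltB e e' a b -> ltA e a -> ltB e' b ->
  liminf_at ltA f a m -> liminf_at ltB g b m.
Proof.
move=> fg ab ea eb [[s [sa hs]] h]; split.
  have [r [sr er rE]] := swo_max woA s e.
  have ra : ltA r a by case: rE => ->.
  have [r' [er' r'b rr']] := isoseg_forth ab er ra.
  exists r'; split=> // u' r'u' u'b.
  have eu' := swo_le_trans woB er' r'u'.
  have [u [eu ua uu']] := isoseg_back ab eu' u'b.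
  rewrite -(fg u u') //; apply: hs => //; apply: swo_le_trans woA _ _ _ sr _.
  case: (swo_le_total woA r u) => // ur.
  by case: (swo_lt_geF woB (isoseg_lt woA woB eu eu' uu' er er' rr' ur)).
move=> s' s'b; have [r' [s'r' er' rE]] := swo_max woB s' e'.
have r'b : ltB r' b by case: rE => ->.
have [r [er ra rr']] := isoseg_back ab er' r'b.
have [u [ru ua fu]] := h r ra; have eu := swo_le_trans woA er ru.
have [u' [eu' u'b uu']] := isoseg_forth ab eu ua.
exists u'; split=> //; last by rewrite -(fg u u').
apply: swo_le_trans woB _ _ _ s'r' _.
case: (swo_le_total woB r' u') => // u'r'.
by case: (swo_lt_geF woA (isoseg_lt woB woA eu' eu (isoseg_sym woA uu') er' er
  (isoseg_sym woA rr') u'r')).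
Qed.

End Agreement.

(** Runs that agree at their base points agree at corresponding times, since the
    configuration at any later time is determined by those from the base point on. *)
Lemma isoseg_agree P y A (ltA : A -> A -> Prop) B (ltB : B -> B -> Prop)
    (cA : A -> config (last_reg P)) (cB : B -> config (last_reg P)) e e' a b :
  strict_well_order ltA -> strict_well_order ltB ->
  (forall t, ltA e t -> follows ltA y cA t) ->
  (forall t, ltB e' t -> follows ltB y cB t) ->
  cA e = cB e' -> le ltA e a -> le ltB e' b ->
  isoseg ltA ltB e e' a b -> cA a = cB b.
Proof.
move=> woA woB fA fB ee'; elim/(well_founded_ind (swo_wf woA)): a b => a IH b ea eb ab.
case: (ea) => [aE|ea'].
  by rewrite aE (isoseg_base woA ab ea eb aE).
have eb' : ltB e' b.
  case: (eb) => // bE; have := isoseg_base woB (isoseg_sym woA ab) eb ea bE.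
  by move=> aE; case: (@swo_irr _ _ woA a); rewrite {1}aE.
have [sA lA] := fA a ea'; have [sB lB] := fB b eb'.
have [[s sa]|nos] := EM (exists s, is_successor ltA s a).
  have es := swo_succ_le woA sa ea'.
  have [s' [es' s'b ss']] := isoseg_forth ab es sa.1.
  have s'b' := isoseg_successor woA woB es es' ab ss' ea eb sa.
  by rewrite (sA s sa) (sB s' s'b') (IH s sa.1 s').
have nosB : forall s', ~ is_successor ltB s' b.
  move=> s' s'b; have es' := swo_succ_le woB s'b eb'.
  have [s [es sa ss']] := isoseg_back ab es' s'b.1.
  apply: nos; exists s.
  exact: (isoseg_successor woB woA es' es (isoseg_sym woA ab) (isoseg_sym woA ss') eb ea s'b).
have nosA : forall s, ~ is_successor ltA s a by move=> s sa; apply: nos; exists s.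
apply: eq_component => j; apply: (limval_at_inj (lA nosA j)).
have E1 : forall u u', le ltA e u -> le ltB e' u' -> ltA u a ->
    isoseg ltA ltB e e' u u' -> component j (cA u) = component j (cB u').
  by move=> u u' eu eu' ua uu'; rewrite (IH u ua u').
have E2 : forall u' u, le ltB e' u' -> le ltA e u -> ltB u' b ->
    isoseg ltB ltA e' e u' u -> component j (cB u') = component j (cA u).
  move=> u' u eu' eu u'b /(isoseg_sym woB) uu'; rewrite (E1 u u') //.
  exact: (isoseg_lt woB woA eu' eu (isoseg_sym woA uu') eb ea (isoseg_sym woA ab) u'b).
case: (lB nosB j) => [h|[h ->]].
  by left; apply: isoseg_liminf E2 (isoseg_sym woA ab) eb' ea' h.
right; split=> // m hm; apply: (h m).
exact: isoseg_liminf E1 ab ea' eb' hm.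
Qed.

(** * The first uncountable ordinal *)

(** These properties characterize the first uncountable ordinal.  Bounds of
    sequences allow closing off under countably many operations, and countability
    of the initial segments keeps what happens below a point within countable
    unions. *)
Definition omega1_like (W : Type) (lt : W -> W -> Prop) : Prop :=
  [/\ strict_well_order lt,
      (exists w0, forall t, le lt w0 t),
      (forall f : nat -> W, exists b, forall k, lt (f k) b) &
      (forall t : W, exists f : nat -> W, forall u, lt u t -> exists k, f k = u)].

Lemma strict_well_order_ex (T : eqType) :
  exists lt : T -> T -> Prop, strict_well_order lt.
Proof.
have [R woR] := well_ordering_principle T.
have wmin (Q : T -> Prop) : (exists x, Q x) -> exists x, Q x /\ forall y, Q y -> R x y.
  move=> [x Qx]; have [|z [[zQ zmin] _]] := woR [pred x | `[< Q x >]].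
    by exists x; apply/asboolP.
  exists z; split; first by move: zQ => /asboolP.
  by move=> y Qy; apply: zmin; apply/asboolP.
have anti x y : R x y -> R y x -> x = y.
  move=> xy yx; have [|z [_ zuniq]] := woR (pred2 x y); first by exists x; rewrite inE eqxx.
  have rr u : R u u.
    by have [|v [-> /(_ u erefl)]] := wmin (fun v => v = u); first by exists u.
  have <- : z = x.
    by apply: zuniq; split; rewrite ?inE ?eqxx // => u; rewrite inE => /orP[]/eqP->.
  by apply: zuniq; split; rewrite ?inE ?eqxx ?orbT // => u; rewrite inE => /orP[]/eqP->.
have tot x y : R x y \/ R y x.
  have [|z [[->|->] h]] := wmin (fun z => z = x \/ z = y); first by exists x; left.
    by left; apply: h; right.
  by right; apply: h; left.
pose lt x y := R x y /\ x <> y; exists lt; split.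
- move=> x; apply: contrapT => nx.
  have [|z [nz zmin]] := wmin (fun z => ~ Acc lt z); first by exists x.
  apply: nz; constructor => y [yz nyz]; apply: contrapT => ny.
  by apply: nyz; apply: anti yz (zmin _ ny).
- move=> s t u [st nst] [tu ntu]; split; last first.
    by move=> su; apply: nst; apply: anti; rewrite // su.
  have [|z [[->|[->|->]] h]] := wmin (fun z => z = s \/ z = t \/ z = u).
  + by exists s; left.
  + by apply: h; right; right.
  + by case: nst; apply: anti st _; apply: h; left.
  + by case: ntu; apply: anti tu _; apply: h; right; left.
- move=> s t; have [->|st] := EM (s = t); first by constructor 2.
  case: (tot s t) => h; [constructor 1|constructor 3]; split=> //.
  by move=> e; apply: st.
Qed.

(** The points of a well-ordering of Cantor space below which there are only
    countably many others form a copy of the first uncountable ordinal. *)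
Lemma omega1_ex : exists (W : Type) (lt : W -> W -> Prop), omega1_like lt.
Proof.
have [lt wo] := strict_well_order_ex {classic creal}.
pose countable_set (S : creal -> Prop) := exists f : nat -> creal, forall u, S u -> exists k, f k = u.
pose small t := countable_set (fun u => lt u t).
have bounded (S : creal -> Prop) : countable_set S -> (forall u v, S v -> lt u v -> S u) ->
    exists b, small b /\ forall u, S u -> lt u b.
  move=> [f Sf] Sdown.
  have [b [nSb bmin]] : exists b, ~ S b /\ forall u, ~ S u -> le lt b u.
    apply: (swo_min wo); exists (fun k => ~~ f k k) => /Sf[k fk].
    by have := congr1 (@^~ k) fk; case: (f k k).
  have bS u : lt u b -> S u.
    by move=> ub; apply: contrapT => /bmin; apply: (swo_lt_geF wo ub).
  exists b; split; first by exists f => u /bS/Sf.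
  move=> u Su; case: (swo_le_total wo b u) => // -[uE|bu]; case: nSb.
    by rewrite -uE.
  exact: Sdown bu.
have [w0 [sw0 _]] : exists b, small b /\ forall u : creal, False -> lt u b.
  by apply: bounded => //; exists (fun=> xpred0).
pose W := {t | small t}; pose ltW (s t : W) := lt (sval s) (sval t).
have inj (s t : W) : sval s = sval t -> s = t.
  by case: s t => [s hs] [t ht] /= st; subst t; congr exist; apply: Prop_irrelevance.
have woW : strict_well_order ltW.
  split.
  + have h x : forall hx : small x, Acc ltW (exist _ x hx).
      elim/(well_founded_ind (swo_wf wo)): x => x IH hx; constructor=> -[y hy] yx.
      exact: IH.
    by case=> x hx; apply: h.
  + by move=> s t u; apply: (swo_trans wo).
  + move=> s t; have [_ _ /(_ (sval s) (sval t))[h|/inj->|h]] := wo.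
    * by constructor 1.
    * by constructor 2.
    * by constructor 3.
exists W, ltW; split=> //.
- have [|w [_ w_min]] := swo_min woW (Q := fun _ => True); first by exists (exist _ w0 sw0).
  by exists w => t; apply: w_min.
- move=> f.
  have /choice[e he] k : exists e : nat -> creal,
      forall u, le lt u (sval (f k)) -> exists i, e i = u.
    have [e he] := svalP (f k).
    exists (fun i => if i is i'.+1 then e i' else sval (f k)) => u [fu|/he[i ei]].
      by exists 0.
    by exists i.+1.
  have [||b [sb hb]] := bounded (fun u => exists k, le lt u (sval (f k))).
  + exists (fun n => if unpickle n is Some (k, i) then e k i else xpred0).
    by move=> u [k /he[i ei]]; exists (pickle (k, i)); rewrite pickleK.
  + by move=> u v [k vk] uv; exists k; right; apply: swo_lt_le_trans wo _ _ _ uv vk.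
  + by exists (exist _ b sb) => k; apply: hb; exists k; left.
- move=> [t st]; have [e he] := st.
  exists (fun k => if pselect (small (e k)) is left h then exist _ (e k) h
                   else exist _ w0 sw0).
  move=> [u su] /he[k ek]; exists k; case: pselect => [h|]; last by rewrite ek.
  exact: inj.
Qed.

Section RunExistence.
Variables (W : Type) (lt : W -> W -> Prop) (P : program) (y : creal).
Hypothesis wo : strict_well_order lt.

Lemma eq_limval_at (f g : W -> nat) t v : (forall u, lt u t -> f u = g u) ->
  limval_at lt f t v -> limval_at lt g t v.
Proof.
move=> fg [h|[h ->]]; first by left; apply: eq_liminf_at h.
by right; split=> // m hm; apply: (h m); apply: eq_liminf_at hm => u ut; rewrite fg.
Qed.

Lemma run_ex (w0 : W) (c0 : config (last_reg P)) :
  exists c : W -> config (last_reg P), c w0 = c0 /\ forall t, lt w0 t -> follows lt y c t.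
Proof.
pose nextP t (h : W -> config (last_reg P)) c := (t = w0 -> c = c0) /\ (lt w0 t ->
  (forall s, is_successor lt s t -> c = stutter y (h s)) /\
  ((forall s, ~ is_successor lt s t) ->
    forall j, limval_at lt (fun u => component j (h u)) t (component j c))).
have /choice[next nextE] (q : W * (W -> config (last_reg P))) : exists c, nextP q.1 q.2 c.
  case: q => t h /=; rewrite /nextP.
  have [->|nt0] := EM (t = w0); first by exists c0; split=> // /(swo_irr wo).
  have [[s st]|nos] := EM (exists s, is_successor lt s t).
    exists (stutter y (h s)); split=> // _; split=> [s' s't|/(_ s)//].
    by rewrite (swo_succ_inj wo st s't).
  have /choice[v vP] j := limval_at_ex lt (fun u => component j (h u)) t.
  exists (Config (v None) [ffun i => v (Some i)]); split=> // _; split=> [s st|_ [i|]] /=.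
  - by case: nos; exists s.
  - by rewrite ffunE; apply: (vP (Some i)).
  - exact: (vP None).
pose ext t (r : forall u, lt u t -> config (last_reg P)) u :=
  if pselect (lt u t) is left h then r u h else c0.
pose F t r := next (t, ext t r).
pose c := Fix (swo_wf wo) (fun _ => config (last_reg P)) F.
have cE t : c t = next (t, fun u => if pselect (lt u t) then c u else c0).
  rewrite /c Fix_eq => [|u f g fg]; last first.
    by congr (F u _); apply: functional_extensionality_dep => a; apply: funext => b.
  rewrite {1}/F; congr (next (t, _)); apply: funext => u; rewrite /ext.
  by case: pselect.
exists c; split; first by rewrite cE; apply: (nextE (_, _)).1.
move=> t w0t; have [_ /(_ w0t)[/= hs hl]] := nextE (t, fun u => if pselect (lt u t) then c u else c0).
rewrite -cE in hs hl; split=> [s st|nos j].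
  by rewrite (hs s st); case: pselect => // -[]; case: st.
by apply: eq_limval_at (hl nos j) => u ut; case: pselect.
Qed.
End RunExistence.

(** * Runs that enter a loop *)

Section Loop.
Variables (P : program) (y : creal).
Variables (W : Type) (lt : W -> W -> Prop) (w0 d1 d2 : W) (d : W -> config (last_reg P)).
Hypotheses (woW : strict_well_order lt) (w0_min : forall t, le lt w0 t).
Hypothesis d_follows : forall t, lt w0 t -> follows lt y d t.
Hypotheses (d12 : lt d1 d2) (d_eq : d d1 = d d2).
Hypothesis d_ge : forall u j, le lt d1 u -> le lt u d2 ->
  (component j (d d1) <= component j (d u))%N.

Lemma halted_in_loop a : le lt a d2 -> step y (d a) = None -> d d1 = d a.
Proof.
move=> ad2 ha; rewrite d_eq; apply: (halted_forever woW) ha ad2 => t at_.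
exact/d_follows/(swo_le_lt_trans woW (w0_min a)).
Qed.

(** If no component drops below its value at the start of the loop, then limits of
    turns are again starts of turns, so the run never leaves the loop; if the
    machine halts, it has done so by the start of the loop. *)
Lemma loop_result n T ltT (c : T -> config (last_reg P)) t :
  d w0 = init P n -> strict_well_order ltT -> is_run y n ltT c ->
  step y (c t) = None -> c t = d d1.
Proof.
move=> d0 woT runT ht.
have [t0 [_ t0_min]] := @swo_min _ _ woT (fun _ => True) (ex_intro _ t I).
have c_follows u : ltT t0 u -> follows ltT y c u.
  by move=> t0u; apply: (run_follows woT runT) => /(_ t0).
have c0 : c t0 = init P n.
  case: runT => h _ _; apply: h => s st0; apply: (swo_lt_geF woT st0).
  exact: t0_min.
have w0d : forall a, le lt w0 a by [].
have agree a b : isoseg ltT lt t0 w0 a b -> c a = d b.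
  move=> ab; apply: (isoseg_agree woT woW c_follows d_follows) ab => //.
    by rewrite c0.
  exact: t0_min.
case: (isoseg_total woT woW (t0_min t I) (w0_min d1)) => [[t1 [_ t1t s]]|[a [_ ad1 s]]|s].
(* The given run reaches the loop: it is compared with a single turn from the
   last start e of a turn up to t. *)
- have ct1 := agree _ _ s.
  pose start e := [/\ le ltT t1 e, le ltT e t, c e = d d1 &
    forall u j, le ltT t1 u -> le ltT u e -> (component j (d d1) <= component j (c u))%N].
  have start1 : start t1.
    split=> // [|| u j t1u ut1]; [by left|by right|].
    by rewrite -(swo_le_anti woT t1u ut1) ct1.
  have [|e|e [et e_ub e_lub]] := @swo_sup _ _ woT start t; [by exists t1|by case|].
  have t1e : le ltT t1 e by apply: e_ub.
  have start_e : start e.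
    apply: contrapT => nstart.
    have starts s' : ltT s' e -> exists e', [/\ start e', ltT s' e' & ltT e' e].
      move=> /e_lub[e' [se' s'e']]; exists e'; split=> //.
      by case: (e_ub _ se') => // eE; case: nstart; rewrite eE.
    apply: nstart.
    have below u j : le ltT t1 u -> ltT u e -> (component j (d d1) <= component j (c u))%N.
      move=> t1u ue; have [e' [[_ _ _ h] ue']] := e_lub u ue.
      by apply: h => //; right.
    have ce : c e = d d1.
      case: (t1e) => [->//|t1e']; apply: eq_component => j.
      have t0e : ltT t0 e by apply: swo_le_lt_trans woT _ _ _ (t0_min t1 I) t1e'.
      apply: limval_at_inj (proj2 (c_follows e t0e) _ j) _ => //.
        by move=> s' [/starts[e' [_ s'e' e'e]] []]; exists e'.
      left; split; first by exists t1; split=> // u t1u ue; apply: below.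
      move=> s' /starts[e' [[_ _ ce' _] s'e' e'e]].
      by exists e'; split=> //; [right|rewrite ce'].
    split=> // u j t1u [uE|ue]; last exact: below.
    by rewrite -uE ce.
  have [_ _ ce e_ge] := start_e.
  have e_follows u : ltT e u -> follows ltT y c u.
    by move=> eu; apply/c_follows/(swo_le_lt_trans woT (t0_min e I)).
  have d1_follows u : lt d1 u -> follows lt y d u.
    by move=> du; apply/d_follows/(swo_le_lt_trans woW (w0_min d1)).
  have agree' a b : le ltT e a -> le lt d1 b -> isoseg ltT lt e d1 a b -> c a = d b.
    exact: (isoseg_agree woT woW e_follows d1_follows ce).
  have d1d2 : le lt d1 d2 by right.
  case: (isoseg_total woT woW et d1d2) => [[t2 [et2 t2t s2]]|[a [d1a ad2 s2]]|s2].
  + suff start2 : start t2.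
      have t2e := swo_le_anti woT (e_ub _ start2) et2.
      have := isoseg_base woT s2 et2 d1d2 t2e => d2E.
      by case: (@swo_irr _ _ woW d1); rewrite -{2}d2E.
    split; [exact: swo_le_trans woT _ _ _ t1e et2|by right|by rewrite (agree' t2 d2)|].
    move=> u j t1u ut2; case: (swo_le_total woT u e) => [ue|eu]; first exact: e_ge.
    case: ut2 => [<-|ut2]; first by rewrite (agree' t2 d2) // d_eq.
    have [b [d1b bd2 ub]] := isoseg_forth s2 (or_intror eu) ut2.
    rewrite (agree' u b) //; last by right.
    by apply: d_ge => //; right.
  + have ct := agree' _ _ et d1a s2; rewrite ct in ht *.
    by rewrite (halted_in_loop _ ht) //; right.
  + have ct := agree' _ _ et d1d2 s2; rewrite ct in ht *.
    by rewrite (halted_in_loop _ ht) //; left.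
- have ct := agree _ _ s; rewrite ct in ht *.
  by rewrite (halted_in_loop _ ht) //; right; apply: swo_trans woW _ _ _ ad1 d12.
- exact: agree.
Qed.
End Loop.

(** * Generic computations *)

Section Generic.
Variables (W : Type) (lt : W -> W -> Prop).
Hypothesis om : omega1_like lt.

Let wo : strict_well_order lt. Proof. by case: om. Qed.

Lemma decided_ex_below a (Q : W -> creal -> Prop) :
  (forall u, lt u a -> decided (Q u)) -> decided (fun z => exists u, lt u a /\ Q u z).
Proof.
move=> hQ; have [_ _ _ /(_ a)[f fa]] := om.
have h k : decided (fun z => lt (f k) a /\ Q (f k) z).
  have [lta|nlt] := EM (lt (f k) a).
    by apply: decided_and; [exact: decided_const|exact: hQ].
  by apply: eq_decided (decided_const False) => z; split=> // -[].
apply: eq_decided (decided_ex h) => z; split=> [[k h']|[u [ua Qu]]]; first by exists (f k).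
by have [k kE] := fa u ua; exists k; rewrite kE.
Qed.

Lemma decided_all_below a (Q : W -> creal -> Prop) :
  (forall u, lt u a -> decided (Q u)) -> decided (fun z => forall u, lt u a -> Q u z).
Proof.
move=> hQ; apply: eq_decided (decided_not (decided_ex_below
  (fun u ua => decided_not (hQ u ua)))) => z.
split=> [h u ua|h [u [ua]]]; last by apply; apply: h.
by apply: contrapT => nQ; apply: h; exists u.
Qed.

Lemma meager_ex_below a (Q : W -> creal -> Prop) :
  (forall u, lt u a -> meager (Q u)) -> meager (fun z => exists u, lt u a /\ Q u z).
Proof.
move=> hQ; have [_ _ _ /(_ a)[f fa]] := om.
have h k : meager (fun z => lt (f k) a /\ Q (f k) z).
  have [lta|nlt] := EM (lt (f k) a); first by apply: sub_meager (hQ _ lta) => z [].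
  by apply: sub_meager meager0 => z [].
apply: sub_meager (meager_ex h) => z [u [ua Qu]].
by have [k kE] := fa u ua; exists k; rewrite kE.
Qed.

Lemma decided_liminf_at (f : creal -> W -> nat) a m :
  (forall u, lt u a -> forall v, decided (fun z => f z u = v)) ->
  decided (fun z => liminf_at lt (f z) a m).
Proof.
move=> hf; apply: decided_and.
  apply: decided_ex_below => s sa.
  apply: (@eq_decided (fun z => forall u, lt u a -> le lt s u -> (m <= f z u)%N)).
    by move=> z; split=> h u; auto.
  apply: decided_all_below => u ua.
  exact: (@decided_bind _ (fun z => f z u) (fun v _ => le lt s u -> (m <= v)%N) (hf u ua)
    (fun v => decided_const _)).
apply: decided_all_below => s sa.
apply: (@eq_decided (fun z => exists u, lt u a /\ (le lt s u /\ (f z u <= m)%N))).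
  by move=> z; split=> -[u]; [move=> [? [? ?]]|move=> [? ? ?]]; exists u.
apply: decided_ex_below => u ua.
exact: (@decided_bind _ (fun z => f z u) (fun v _ => le lt s u /\ (v <= m)%N) (hf u ua)
    (fun v => decided_const _)).
Qed.

Lemma decided_limval_at (f : creal -> W -> nat) a v :
  (forall u, lt u a -> forall v, decided (fun z => f z u = v)) ->
  decided (fun z => limval_at lt (f z) a v).
Proof.
move=> hf; apply: decided_or; first exact: decided_liminf_at.
apply: decided_and; last exact: decided_const.
by apply: decided_all => m; apply/decided_not/decided_liminf_at.
Qed.

Section GenericRun.
Variables (P : program) (o : creal -> creal) (w0 : W).
Variables (run : creal -> W -> config (last_reg P)) (c0 : config (last_reg P)).
Hypothesis o_decided : forall k b, decided (fun z => o z k = b).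
Hypothesis w0_min : forall t, le lt w0 t.
Hypothesis run0 : forall y, run y w0 = c0.
Hypothesis run_next : forall y t, lt w0 t -> follows lt y (run y) t.

Lemma decided_config_bind (f : creal -> config (last_reg P)) (B : config (last_reg P) -> creal -> Prop) :
  (forall c, decided (fun z => f z = c)) -> (forall c, decided (B c)) ->
  decided (fun z => B (f z) z).
Proof.
move=> hf hB.
pose enc (c : config (last_reg P)) := (line c, regs c).
apply: (@eq_decided (fun z => (fun q => B (Config q.1 q.2)) (enc (f z)) z)).
  by move=> z /=; case: (f z).
apply: (@decided_bind (nat * {ffun 'I_(last_reg P).+1 -> nat})%type (fun z => enc (f z))
  (fun q => B (Config q.1 q.2))) => // -[l r].
by apply: eq_decided (hf (Config l r)) => z; case: (f z) => l' r'; split=> [[-> ->]|[-> ->]].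
Qed.

Lemma decided_stutter c c' : decided (fun z => stutter (o z) c = c' :> config (last_reg P)).
Proof.
rewrite /stutter /step; case: (onth _ _) => [I|] /=; last exact: decided_const.
case: I => [i|i|i j|i j q|i] /=; try exact: decided_const.
exact: (@decided_bind _ (fun z => o z (regs c i))
  (fun b _ => Config (line c).+1 (set_reg (regs c) i (nat_of_bool b)) = c')
  (o_decided _) (fun b => decided_const _)).
Qed.

(** The successor clause asks one bit of the oracle, and the limit clause
    quantifies over the earlier times only, of which there are countably many. *)
Lemma decided_run a c : decided (fun z => run (o z) a = c).
Proof.
elim/(well_founded_ind (swo_wf wo)): a c => a IH c.
case: (w0_min a) => [->|w0a].
  by apply: eq_decided (decided_const (c0 = c)) => z; rewrite run0.
have [[s sa]|nos] := EM (exists s, is_successor lt s a).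
  apply: (@eq_decided (fun z => stutter (o z) (run (o z) s) = c)).
    by move=> z; rewrite ((run_next (o z) w0a).1 s sa).
  apply: (@decided_config_bind _ (fun d z => stutter (o z) d = c)).
    by apply: IH; case: sa.
  by move=> d; apply: decided_stutter.
apply: (@eq_decided (fun z => forall j : option 'I_(last_reg P).+1,
   limval_at lt (fun u => component j (run (o z) u)) a (component j c))).
  move=> z.
  have h := (run_next (o z) w0a).2 (fun s sa => nos (ex_intro _ s sa)).
  split=> [hc|<-]; last exact: h.
  by apply: eq_component => j; apply: limval_at_inj (h j) (hc j).
apply: decided_all => j; apply: decided_limval_at => u ua v.
by apply: (@decided_config_bind _ (fun d _ => component j d = v)) => [d|d];
  [apply: IH|apply: decided_const].
Qed.

Lemma decided_component a j v : decided (fun z => (component j (run (o z) a) < v)%N).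
Proof.
apply: (@decided_config_bind _ (fun d _ => (component j d < v)%N)) => c.
  exact: decided_run.
exact: decided_const.
Qed.

(** Only countably many events are watched, so from some countable time on
    only those occur that occur again and again; closing under their occurrences
    gives arbitrarily large limits of occurrences of all of them. *)
Lemma recurrence (Q : countType) (hit : W -> Q -> Prop) :
  exists d0, forall s0, exists d, [/\ lt s0 d,
    forall s, ~ is_successor lt s d &
    forall q u s, le lt d0 u -> hit u q -> lt s d ->
      exists u', [/\ le lt s u', lt u' d & hit u' q]].
Proof.
have [_ _ bounded _] := om.
have ub (f : Q -> W) s : exists b, lt s b /\ forall q, lt (f q) b.
  have [b hb] := bounded (fun n => if n is n'.+1 then
    (if unpickle n' is Some q then f q else s) else s).
  by exists b; split=> [|q]; [exact: (hb 0)|have := hb (pickle q).+1; rewrite pickleK].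
pose cofinal q := forall s, exists u, le lt s u /\ hit u q.
have /choice[stop hstop] q : exists s, cofinal q \/ forall u, le lt s u -> ~ hit u q.
  have [|/existsNP[s hs]] := EM (cofinal q); first by exists w0; left.
  by exists s; right=> u su hu; apply: hs; exists u.
have [d0 [_ hd0]] := ub stop w0.
have cof q u : le lt d0 u -> hit u q -> cofinal q.
  move=> d0u hu; case: (hstop q) => // /(_ u); case=> //.
  by right; apply: swo_lt_le_trans wo _ _ _ (hd0 q) d0u.
have /choice[w hw] (sq : W * Q) : exists u, cofinal sq.2 -> le lt sq.1 u /\ hit u sq.2.
  case: sq => s q /=; have [/(_ s)[u hu]|n] := EM (cofinal q); first by exists u.
  by exists s.
have /choice[next hnext] s := ub (fun q => w (s, q)) s.
exists d0 => s0; pose t := fix t n := if n is n'.+1 then next (t n') else s0.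
have [b hb] := bounded t.
have [||d [_ d_ub d_lub]] := @swo_sup _ _ wo (fun u => exists n, u = t n) b.
- by exists s0; exists 0.
- by move=> u [n ->]; right.
have td n : lt (t n) d.
  apply: swo_lt_le_trans wo _ _ _ (hnext (t n)).1 _.
  by apply: d_ub; exists n.+1.
exists d; split=> [|s [sd []]|q u s d0u hu sd]; first exact: (td 0).
  by have [_ [[n ->] sn]] := d_lub s sd; exists (t n).
have [_ [[n ->] sn]] := d_lub s sd.
have [tw hitw] := hw (t n, q) (cof q u d0u hu).
exists (w (t n, q)); split=> //; first by right; apply: swo_lt_le_trans wo _ _ _ sn tw.
exact: swo_trans wo _ _ _ ((hnext (t n)).2 q) (td n.+1).
Qed.

(** The watched events are that a condition forces a component to be small.  On
    generic oracles, whatever small value occurs after d0 is forced, hence recurs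
    cofinally below d1 and d2, and the inferior limits at d1 and at d2 are both the
    minima of the components from d0 on. *)
Lemma generic_loop : exists d1 d2, lt d1 d2 /\
  meager (fun z => ~ (run (o z) d1 = run (o z) d2 /\
    forall u j, le lt d1 u -> le lt u d2 ->
      (component j (run (o z) d1) <= component j (run (o z) u))%N)).
Proof.
pose I := ('I_(last_reg P).+1); pose Q := (seq bool * (option I * nat))%type.
pose small z u (jv : option I * nat) := (component jv.1 (run (o z) u) < jv.2)%N.
pose hit u (q : Q) := forces q.1 (fun z => small z u q.2).
have [d0 rec] := recurrence hit.
have [d1 [d01 lim1 h1]] := rec d0; have [d2 [d12 lim2 h2]] := rec d1.
have [_ _ /(_ (fun=> d2))[b /(_ 0) d2b] _] := om.
pose M1 z := exists u, lt u b /\ exists jv, small z u jv /\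
  ~ exists p, cylinder p z /\ forces p (fun z => small z u jv).
pose M2 z := exists u, lt u b /\ exists q : Q, hit u q /\ cylinder q.1 z /\ ~ small z u q.2.
have mM1 : meager M1.
  apply: meager_ex_below => u _; apply: meager_ex => -[j v].
  exact/decided_forced/decided_component.
have mM2 : meager M2.
  apply: meager_ex_below => u _; apply: meager_ex => q.
  have [h|nh] := EM (hit u q); first by apply: sub_meager h => z [].
  by apply: sub_meager meager0 => z [].
exists d1, d2; split=> //; apply: sub_meager (meagerU mM1 mM2) => z bad.
apply: contrapT => good; apply: bad.
have recur d u s jv : (d = d1 \/ d = d2) -> le lt d0 u -> lt u b -> small z u jv ->
    lt s d -> exists u', [/\ le lt s u', lt u' d & small z u' jv].
  move=> dE d0u ub su sd.
  have [p [zp pu]] : exists p, cylinder p z /\ forces p (fun z => small z u jv).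
    by apply: contrapT => n; apply: good; left; exists u; split=> //; exists jv.
  have [u' [su' u'd pu']] : exists u', [/\ le lt s u', lt u' d & hit u' (p, jv)].
    by case: dE => dE; subst d; [apply: (h1 (p, jv) u)|apply: (h2 (p, jv) u)].
  exists u'; split=> //; apply: contrapT => n; apply: good; right.
  exists u'; split; last by exists (p, jv).
  apply: swo_lt_le_trans wo _ _ _ u'd _; right.
  by case: dE => ->; [apply: swo_trans wo _ _ _ d12 d2b|].
have d0b : lt d0 b by apply: swo_trans wo _ _ _ (swo_trans wo d01 d12) d2b.
have val_at j : exists m, (forall u, le lt d0 u -> lt u b -> (m <= component j (run (o z) u))%N) /\
    forall d, d = d1 \/ d = d2 -> component j (run (o z) d) = m.
  pose R v := `[< exists u, [/\ le lt d0 u, lt u b & component j (run (o z) u) = v] >].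
  have R0 : exists v, R v.
    by exists (component j (run (o z) d0)); apply/asboolP; exists d0; split=> //; left.
  case: (ex_minnP R0) => m /asboolP[u [d0u ub um]] m_min.
  have m_le v : le lt d0 v -> lt v b -> (m <= component j (run (o z) v))%N.
    by move=> d0v vb; apply: m_min; apply/asboolP; exists v.
  exists m; split=> // d dE.
  have d0d : lt d0 d by case: dE => ->//; apply: swo_trans wo _ _ _ d01 d12.
  have db : lt d b by case: dE => ->//; apply: swo_trans wo _ _ _ d12 d2b.
  have w0d : lt w0 d by apply: swo_le_lt_trans wo _ _ _ (w0_min d0) d0d.
  have um' : small z u (j, m.+1) by rewrite /small /= um.
  apply: limval_at_inj ((run_next (o z) w0d).2 _ j) _.
    by case: dE => ->.
  left; split.
    exists d0; split=> // v d0v vd; apply: m_le => //.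
    exact: swo_trans wo _ _ _ vd db.
  move=> s sd; have [u' [su' u'd]] := recur d u s _ dE d0u ub um' sd.
  by exists u'.
have at1 j m : (forall d, d = d1 \/ d = d2 -> component j (run (o z) d) = m) ->
    component j (run (o z) d1) = m /\ component j (run (o z) d2) = m.
  by move=> h; split; apply: h; [left|right].
split.
  by apply: eq_component => j; have [m [_ /at1[-> ->]]] := val_at j.
move=> u j d1u ud2; have [m [m_le /at1[-> _]]] := val_at j; apply: m_le.
  by apply: swo_le_trans wo _ _ _ _ d1u; right.
exact: swo_le_lt_trans wo _ _ _ ud2 d2b.
Qed.
End GenericRun.

(** The function g reads the output off at the start of a loop that is common to
    all generic oracles.  It is a function of the oracle alone, so that equal
    oracles get equal predictions. *)
Lemma generic_evaluation P n (o : creal -> creal) :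
  (forall k b, decided (fun z => o z k = b)) ->
  exists g : creal -> nat, (forall v, decided (fun z => g (o z) = v)) /\
    meager (fun z => exists m, computes P (o z) n m /\ g (o z) <> m).
Proof.
move=> ho; have [_ [w0 w0_min] _ _] := om.
have /choice[run hrun] y := run_ex y wo w0 (init P n).
have run0 y : run y w0 = init P n by case: (hrun y).
have run_next y : forall t, lt w0 t -> follows lt y (run y) t by case: (hrun y).
have [d1 [d2 [d12 bad]]] := generic_loop ho w0_min run0 run_next.
exists (fun y => regs (run y d1) ord0); split=> [v|].
  apply: (@decided_config_bind _ (fun z => run (o z) d1) (fun c _ => regs c ord0 = v)).
    exact: (decided_run ho w0_min run0 run_next).
  by move=> c; apply: decided_const.
apply: sub_meager bad => z [m [[T [ltT [c [t [woT runT ht tm]]]]] gm]] [d_eq d_ge].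
apply: gm; rewrite -tm.
by rewrite (loop_result wo w0_min (run_next _) d12 d_eq d_ge (run0 _) woT runT ht).
Qed.
End Generic.

(** * A decidable null set *)

Definition even_supported (x : creal) : Prop := forall k, odd k -> x k = false.

Section Null.
Import Order.TTheory GRing.Theory Num.Theory.
Local Open Scope classical_set_scope.
Local Open Scope ring_scope.

(** The set is covered by the 2^N cylinders of length 2N that its points pass
    through, of total measure 2^-N; shrinking cylinders of the same total measure
    continue them to an infinite sequence. *)
Definition even_cover (N k : nat) : seq bool :=
  if (k < 2 ^ N)%N then
    mkseq (fun i => ~~ odd i && nth false (nth [tuple of nseq N false] (enum {: N.-tuple bool}) k) i./2) N.*2
  else nseq (N + k.+1) false.

Lemma even_coverP N x : even_supported x -> exists k, cylinder (even_cover N k) x.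
Proof.
move=> hx; pose w := [tuple x (i : 'I_N).*2 | i < N].
have wk : (index w (enum {: N.-tuple bool}) < 2 ^ N)%N.
  have <- : #|{: N.-tuple bool}| = (2 ^ N)%N by rewrite card_tuple card_bool.
  by rewrite cardE index_mem mem_enum.
exists (index w (enum {: N.-tuple bool})); rewrite /even_cover wk => i.
rewrite size_mkseq => iN; rewrite nth_mkseq // nth_index ?mem_enum //.
case: (boolP (odd i)) => [/hx//|oi] /=.
have i2 : (i./2 < N)%N by lia.
by rewrite (nth_mktuple _ _ (Ordinal i2)) /= even_halfK.
Qed.

Lemma even_cover_sum (R : realType) N n :
  \sum_(0 <= k < n) (2^-1 : R) ^+ size (even_cover N k) <=
  (minn n (2 ^ N))%:R * 2^-1 ^+ N.*2 + 2^-1 ^+ N * (1 - 2^-1 ^+ n).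
Proof.
elim: n => [|n IH]; first by rewrite big_geq // min0n mul0r expr0 subrr mulr0 addr0.
rewrite big_nat_recr //=.
have -> : size (even_cover N n) = if (n < 2 ^ N)%N then N.*2 else (N + n.+1)%N.
  by rewrite /even_cover; case: ifP; rewrite ?size_mkseq ?size_nseq.
have hN : 0 <= (2^-1 : R) ^+ N by rewrite exprn_ge0.
have hn : 0 <= (2^-1 : R) ^+ n by rewrite exprn_ge0.
have hNn := mulr_ge0 hN hn.
case: ltnP => nN.
  rewrite (minn_idPl nN); rewrite (minn_idPl (ltnW nN)) in IH.
  by rewrite -(natr1 n) (exprS _ n); lra.
rewrite (minn_idPr (leqW nN)); rewrite (minn_idPr nN) in IH.
by rewrite exprD (exprS _ n); lra.
Qed.

Lemma even_supported_null (R : realType) : outer_lebesgue R even_supported = 0%E.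
Proof.
apply/eqP; rewrite eq_le; apply/andP; split; last first.
  apply: le_ereal_inf_tmp => _ [s _ <-].
  by apply: nneseries_ge0 => k _ _; rewrite lee_fin exprn_ge0.
apply/lee_addgt0Pr => e e0; rewrite add0e; apply: ge_ereal_inf.
pose N := Num.bound (2 / e).
have hN : 2 * (2^-1 : R) ^+ N <= e.
  have := upper_nthrootP (leqnn N); rewrite exprVn ltr_pdivrMr // => h.
  by rewrite ler_pdivrMr ?exprn_gt0 // mulrC ltW.
exists (\sum_(0 <= k <oo) ((2%:R^-1 : R) ^+ size (even_cover N k))%:E)%E.
  exists (even_cover N) => //= x /(even_coverP N)[k hk].
  by exists k.
apply: lime_le.
  by apply: is_cvg_nneseries => k _ _; rewrite lee_fin exprn_ge0.
apply: nearW => n; rewrite sumEFin lee_fin.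
apply: le_trans (even_cover_sum R N n) _; apply: le_trans hN.
have h0 : 0 <= (2^-1 : R) ^+ N by rewrite exprn_ge0.
have hn : 0 <= (2^-1 : R) ^+ n by rewrite exprn_ge0.
rewrite [2 * _]mulr_natl mulr2n; apply: lerD; last by nra.
apply: (@le_trans _ _ ((2 ^ N)%:R * 2^-1 ^+ N.*2)).
  by rewrite ler_wpM2r ?exprn_ge0 // ler_nat geq_minr.
by rewrite -addnn exprD mulrA natrX exprVn divff ?mul1r // expf_neq0 // pnatr_eq0.
Qed.
End Null.

(** Two sequences of configurations suffice for a computation of length less than
    omega times two; the time (b, i) is i, or omega + i if b is true. *)
Section OmegaTwo.

Definition time_lt (u v : bool * nat) : bool :=
  (~~ u.1 && v.1) || (u.1 == v.1) && (u.2 < v.2)%N.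

Definition time_le (u v : bool * nat) : bool := (u == v) || time_lt u v.

Lemma time_lt_trans : transitive time_lt.
Proof. by move=> [[] v] [[] u] [[] w]; rewrite /time_lt //=; apply: ltn_trans. Qed.

Lemma time_lt_total u v : [\/ time_lt u v, u = v | time_lt v u].
Proof.
case: u v => [b i] [b' j]; rewrite /time_lt /=.
have [ij|ji|->] := ltngtP i j; case: b b' => -[] /=;
  by [constructor 1|constructor 2|constructor 3].
Qed.

Lemma time_lt_wf : well_founded time_lt.
Proof.
have acc0 i : Acc time_lt (false, i).
  elim/ltn_ind: i => i IH; constructor=> -[b j]; rewrite /time_lt /=.
  by case: b => [//|ji]; apply: IH.
have acc1 i : Acc time_lt (true, i).
  elim/ltn_ind: i => i IH; constructor=> -[b j]; rewrite /time_lt /=.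
  by case: b => /= ji; [apply: IH|apply: acc0].
by case=> -[] i.
Qed.

Variable h : bool * nat.
Let T := {v | time_le v h}.
Let ltT (s t : T) : Prop := time_lt (sval s) (sval t).

Lemma time_swo : strict_well_order ltT.
Proof.
split.
- move=> [v hv]; elim/(well_founded_ind time_lt_wf): v hv => v IH hv.
  by constructor=> -[u hu] uv; apply: IH.
- by move=> s t u; apply: time_lt_trans.
- move=> s t; case: (time_lt_total (sval s) (sval t)) => st.
  + by constructor 1.
  + by constructor 2; apply: val_inj.
  + by constructor 3.
Qed.

Lemma time_down u v : time_lt u v -> time_le v h -> time_le u h.
Proof.
move=> uv /orP[/eqP<-|vh]; rewrite /time_le; apply/orP; right=> //.
exact: time_lt_trans vh.
Qed.

Definition nat_liminf (f : nat -> nat) (m : nat) : Prop :=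
  (exists N, forall i, (N <= i)%N -> (m <= f i)%N) /\
  (forall N, exists2 i, (N <= i)%N & (f i <= m)%N).

Lemma omega_liminf (f : bool * nat -> nat) (t : T) m : sval t = (true, 0) ->
  finite_liminf ltT (fun u => f (sval u)) t m <-> nat_liminf (fun i => f (false, i)) m.
Proof.
move=> tE; rewrite (liminf_atP time_swo).
have below (s : T) : ltT s t -> exists i, sval s = (false, i).
  by rewrite /ltT tE; case: (sval s) => -[] i //= _; exists i.
have point i : exists s : T, sval s = (false, i) /\ ltT s t.
  have hi : time_le (false, i) h.
    by apply: (@time_down _ (sval t)); rewrite ?tE //; rewrite -tE; case: t {tE below}.
  by exists (exist (fun v => is_true (time_le v h)) _ hi); split=> //; rewrite /ltT /= tE.
have leE (s u : T) i j : sval s = (false, i) -> sval u = (false, j) ->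
    le ltT s u <-> (i <= j)%N.
  move=> si uj; rewrite leq_eqVlt; split=> [[us|su]|/predU1P[ij|ij]].
  - by move: uj; rewrite us si => -[->]; rewrite eqxx.
  - by move: su; rewrite /ltT si uj /time_lt /= => ->; rewrite orbT.
  - by left; apply: val_inj; rewrite /= si uj ij.
  - by right; rewrite /ltT si uj.
split=> -[[s h1] h2].
  case: h1 => st h1; split.
    have [N sN] := below s st; exists N => i Ni; have [u [ui ut]] := point i.
    by rewrite -ui; apply: h1 => //; apply/(leE _ _ _ _ sN ui).
  move=> N; have [u [uN ut]] := point N; have [v [uv vt fv]] := h2 u ut.
  have [i vi] := below v vt; exists i; last by rewrite -vi.
  exact/(leE _ _ _ _ uN vi).
split.
  have [u [us ut]] := point s; exists u; split=> // v uv vt.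
  have [i vi] := below v vt; rewrite vi; apply: h1.
  exact/(leE _ _ _ _ us vi).
move=> u ut; have [N uN] := below u ut; have [i Ni fi] := h2 N.
have [v [vi vt]] := point i; exists v; split=> //; last by rewrite vi.
exact/(leE _ _ _ _ uN vi).
Qed.

Lemma computes_omega2 P y n (c : bool * nat -> config (last_reg P)) :
  c (false, 0) = init P n ->
  (forall b i, time_le (b, i.+1) h -> step y (c (b, i)) = Some (c (b, i.+1))) ->
  (h.1 -> nat_liminf (fun i => line (c (false, i))) (line (c (true, 0))) /\
    forall r, nat_liminf (fun i => regs (c (false, i)) r) (regs (c (true, 0)) r) \/
      (forall m, ~ nat_liminf (fun i => regs (c (false, i)) r) m) /\
      regs (c (true, 0)) r = 0) ->
  step y (c h) = None ->
  computes P y n (regs (c h) ord0).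
Proof.
move=> c0 cS climit ch.
have hh : time_le h h by rewrite /time_le eqxx.
exists T, ltT, (fun t : T => c (sval t)), (exist (fun v => is_true (time_le v h)) h hh).
split; [exact: time_swo| |exact: ch|by []].
have h0 : time_le (false, 0) h.
  by case: h => -[] [|i]; rewrite /time_le /time_lt.
split.
- move=> [[b i] t] tz /=; have := tz (exist (fun v => is_true (time_le v h)) _ h0); rewrite /ltT /time_lt /=.
  by case: b i {tz} t => -[|i] // _ [].
- move=> [u su] [[b [|i]] t] [/= ut hbetween].
    case: b t ut hbetween => t; case: u su => -[] j // su ut []; rewrite /ltT in ut *.
    have sj : time_le (false, j.+1) h by apply: (@time_down _ (true, 0)).
    by exists (exist (fun v => is_true (time_le v h)) _ sj); rewrite /ltT /time_lt /=.
  have si : time_le (b, i) h.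
    by apply: (time_down _ t); rewrite /time_lt /= ltnSn eqxx orbT.
  case: (time_lt_total u (b, i)) => [ui|->|iu]; last 2 first.
  + exact: cS.
  + exfalso; move: ut iu; rewrite /ltT /time_lt /=; clear.
    by case: u b => -[] j [] //=; lia.
  + case: hbetween; exists (exist (fun v => is_true (time_le v h)) _ si); rewrite /ltT /=; split=> //.
    by rewrite /time_lt /= ltnSn eqxx orbT.
- move=> t [tz tl].
  have tE : sval t = (true, 0).
    case: t tz tl => -[b [|i]] /= t tz tl.
      by case: b t tz tl => // t []; move=> [[[] j] s]; rewrite /ltT /time_lt.
    have si : time_le (b, i) h.
      by apply: (time_down _ t); rewrite /time_lt /= ltnSn eqxx orbT.
    case: (tl (exist (fun v => is_true (time_le v h)) _ si)); split.
      by rewrite /ltT /time_lt /= ltnSn eqxx orbT.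
    move=> [[[b' j] s] []]; rewrite /ltT /time_lt /=; clear.
    by case: b b' => -[] //=; lia.
  have h1 : h.1.
    by have := svalP t; rewrite tE; case: h => -[] j.
  have [hl hr] := climit h1; rewrite tE; split.
    by apply/(omega_liminf (fun u => line (c u)) _ tE).
  move=> r; case: (hr r) => [hr'|[hr' r0]]; [left|right].
    by apply/(omega_liminf (fun u => regs (c u) r) _ tE).
  by split=> // m /(omega_liminf (fun u => regs (c u) r) _ tE)/hr'.
Qed.
End OmegaTwo.

Definition reg1 : 'I_3 := @Ordinal 3 1 isT.
Definition reg2 : 'I_3 := @Ordinal 3 2 isT.

(** Register 1 runs through the odd numbers and overflows to 0 only if no odd
    bit of the oracle is set; register 2 is scratch space, and register 0 is the
    constant 0 until the answer is known. *)
Definition scan_program : program := @Program 2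
  [:: Succ reg1;
      JumpEq reg1 ord0 8;
      Copy reg2 reg1;
      Oracle reg2;
      Succ reg1;
      Succ reg1;
      JumpEq reg2 ord0 1;
      JumpEq ord0 ord0 9;
      Succ ord0].

Definition scan_config (l a b d : nat) : config 2 :=
  Config l [ffun i : 'I_3 => nth 0 [:: a; b; d] i].

(** The configuration r steps after the start of the turn that reads bit 2q+1. *)
Definition scan_turn (y : creal) (q r : nat) : config 2 :=
  match r with
  | 0 => scan_config 1 0 q.*2.+1 0
  | 1 => scan_config 2 0 q.*2.+1 0
  | 2 => scan_config 3 0 q.*2.+1 q.*2.+1
  | 3 => scan_config 4 0 q.*2.+1 (y q.*2.+1)
  | 4 => scan_config 5 0 q.*2.+2 (y q.*2.+1)
  | _ => scan_config 6 0 q.*2.+3 (y q.*2.+1)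
  end.

Definition scan_time (y : creal) (i : nat) : config 2 :=
  if i is i'.+1 then scan_turn y (i' %/ 6) (i' %% 6) else scan_config 0 0 0 0.

Lemma ffun3_eq (f g : {ffun 'I_3 -> nat}) :
  f ord0 = g ord0 -> f reg1 = g reg1 -> f reg2 = g reg2 -> f = g.
Proof.
move=> h0 h1 h2; apply/ffunP => -[[|[|[|//]]] hi].
- by rewrite (_ : Ordinal hi = ord0) //; apply: val_inj.
- by rewrite (_ : Ordinal hi = reg1) //; apply: val_inj.
- by rewrite (_ : Ordinal hi = reg2) //; apply: val_inj.
Qed.

Lemma scan_config_eq c l a b d : line c = l -> regs c ord0 = a ->
  regs c reg1 = b -> regs c reg2 = d -> c = scan_config l a b d.
Proof.
case: c => l' f /= -> h0 h1 h2; congr Config.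
by apply: ffun3_eq; rewrite !ffunE.
Qed.

Lemma scan_step_turn y q r : (r < 5)%N ->
  step (P := scan_program) y (scan_turn y q r) = Some (scan_turn y q r.+1).
Proof.
case: r => [|[|[|[|[|//]]]]] _; rewrite /step /=; congr Some;
  by apply: scan_config_eq => /=; rewrite ?ffunE /= ?ffunE.
Qed.

Lemma scan_step_continue y q : y q.*2.+1 = false ->
  step (P := scan_program) y (scan_turn y q 5) = Some (scan_turn y q.+1 0).
Proof.
move=> yq; rewrite /step /=; congr Some.
by apply: scan_config_eq => /=; rewrite ?ffunE /= ?ffunE ?yq.
Qed.

Lemma scan_step_reject y q : y q.*2.+1 = true ->
  step (P := scan_program) y (scan_turn y q 5) = Some (scan_config 7 0 q.*2.+3 1).
Proof.
move=> yq; rewrite /step /=; congr Some.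
by apply: scan_config_eq => /=; rewrite ?ffunE /= ?ffunE ?yq.
Qed.

Lemma scan_step_time y i : (forall q, (q * 6 + 6 <= i)%N -> y q.*2.+1 = false) ->
  step (P := scan_program) y (scan_time y i) = Some (scan_time y i.+1).
Proof.
case: i => [|i] hy.
  rewrite /step /=; congr Some.
  by apply: scan_config_eq => /=; rewrite ?ffunE /= ?ffunE.
rewrite /scan_time; have [r5|r5] := ltnP (i %% 6) 5.
  rewrite scan_step_turn //; congr (Some (scan_turn _ _ _)); lia.
have -> : i %% 6 = 5 by lia.
have -> : i.+1 %% 6 = 0 by lia.
have -> : i.+1 %/ 6 = (i %/ 6).+1 by lia.
by apply: scan_step_continue; apply: hy; lia.
Qed.

Lemma scan_turnE y q r : (r < 6)%N -> scan_time y (q * 6 + r).+1 = scan_turn y q r.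
Proof.
by move=> r6; rewrite /scan_time divnMDl // modnMDl divn_small // modn_small // addn0.
Qed.

Lemma even_supported_decidable : ITRM_decidable even_supported.
Proof.
exists scan_program => y; split=> hy.
- have yq q : y q.*2.+1 = false by apply: hy; rewrite /= odd_double.
  pose c (t : bool * nat) : config 2 := match t with
    | (false, i) => scan_time y i
    | (true, 0) => scan_config 1 0 0 0
    | (true, 1) => scan_config 8 0 0 0
    | _ => scan_config 9 1 0 0
    end.
  suff : computes scan_program y 0 (regs (c (true, 2)) ord0) by rewrite /= ffunE.
  have turn q i : (q * 6 < i)%N -> (0 < line (scan_time y i))%N /\
      (q < regs (scan_time y i) reg1)%N.
    case: i => [|i] //= qi; have : (q <= i %/ 6)%N by lia.
    have : (i %% 6 < 6)%N by lia.
    move: (i %/ 6) (i %% 6) => p [|[|[|[|[|[|//]]]]]] _ qp; rewrite /= ffunE /=; lia.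
  apply: (computes_omega2 (P := scan_program)) => //.
  + by apply/esym/scan_config_eq => //=; rewrite ffunE.
  + move=> [] i hi; last by apply: scan_step_time => q _.
    case: i hi => [|[|i]] //= _; rewrite /step /=; congr Some;
      by apply: scan_config_eq => /=; rewrite ?ffunE /= ?ffunE.
  + move=> _; split.
      split; first by exists 1 => i i0; have [] := turn 0 i i0.
      move=> N; exists (N * 6 + 0).+1; first by lia.
      by rewrite /c scan_turnE.
    have often0 (f : nat -> nat) : (forall q, f (q * 6 + 0).+1 = 0) -> nat_liminf f 0.
      move=> hf; split; first by exists 0.
      by move=> N; exists (N * 6 + 0).+1; [lia|rewrite hf].
    move=> [[|[|[|//]]] hr].
    * rewrite (_ : Ordinal hr = ord0); last exact: val_inj.
      by left; rewrite /= ffunE /=; apply: often0 => q; rewrite scan_turnE //= ffunE.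
    * rewrite (_ : Ordinal hr = reg1); last exact: val_inj.
      right; split; last by rewrite /= ffunE.
      move=> m [_ /(_ (m * 6).+1)[i mi /=]].
      by have [_] := turn m i mi; lia.
    * rewrite (_ : Ordinal hr = reg2); last exact: val_inj.
      by left; rewrite /= ffunE /=; apply: often0 => q; rewrite scan_turnE //= ffunE.
- have : exists q, y q.*2.+1.
    apply: contrapT => none; apply: hy => k ok; apply/negbTE/negP => yk.
    by apply: none; exists k./2; rewrite odd_halfK ?prednK ?odd_gt0.
  case/ex_minnP => q yq q_min.
  pose n := (q * 6 + 5).+1.
  pose c (t : bool * nat) : config 2 :=
    if (t.2 <= n)%N then scan_time y t.2
    else if t.2 == n.+1 then scan_config 7 0 q.*2.+3 1 else scan_config 9 0 q.*2.+3 1.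
  have ch : c (false, n.+2) = scan_config 9 0 q.*2.+3 1.
    by rewrite /c /= ltnNge leqnSn /= eqn_leq ltnn.
  suff : computes scan_program y 0 (regs (c (false, n.+2)) ord0) by rewrite ch ffunE.
  apply: (computes_omega2 (P := scan_program)) => //.
  + by apply/esym/scan_config_eq => //=; rewrite ffunE.
  + move=> b i; rewrite /time_le /time_lt xpair_eqE /= => hi.
    have {hi} : (i < n.+2)%N by case: b hi; rewrite /= ?andbF //; lia.
    rewrite ltnS leq_eqVlt => /predU1P[->|].
      rewrite /c /= ltnn eqxx.
      have -> : (n.+2 <= n)%N = false by lia.
      have -> : (n.+2 == n.+1) = false by lia.
      rewrite /step /=; congr Some.
      by apply: scan_config_eq => /=; rewrite ?ffunE /= ?ffunE.
    rewrite ltnS leq_eqVlt => /predU1P[->|i_n].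
      by rewrite /c leqnn ltnn eqxx -(scan_step_reject yq) -scan_turnE.
    rewrite /c /= ltnW // i_n; apply: scan_step_time => p hp.
    by apply/negbTE/negP => /q_min; rewrite /n in i_n; lia.
  + by rewrite ch.
Qed.

(** * Generic reals on the even bits *)

Definition spread (z : creal) : creal := fun k => ~~ odd k && z k./2.

Lemma spread_even z : even_supported (spread z).
Proof. by move=> k ok; rewrite /spread ok. Qed.

Lemma spread_double z j : spread z j.*2 = z j.
Proof. by rewrite /spread odd_double doubleK. Qed.

Lemma decided_delete_spread n k b : decided (fun z => delete_bit n (spread z) k = b).
Proof.
have h i : decided (fun z => spread z i = b).
  by rewrite /spread; case: (odd i) => /=; [apply: (decided_const (false = b))|apply: decided_bit].
by rewrite /delete_bit; case: (k < n)%N.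
Qed.

Lemma delete_spread_flip j z :
  delete_bit j.*2 (spread (flip j z)) = delete_bit j.*2 (spread z).
Proof.
have h i : i <> j.*2 -> spread (flip j z) i = spread z i.
  move=> ij; rewrite /spread /flip; case: (boolP (odd i)) => //= oi.
  have [iE|] := eqVneq i./2 j; last by [].
  by case: ij; rewrite -iE even_halfK.
apply: funext => k; rewrite /delete_bit; case: ltnP => jk; apply: h => kE.
  by rewrite kE ltnn in jk.
by rewrite -kE ltnn in jk.
Qed.

Definition autoreduces (P : program) (x : creal) : Prop :=
  forall n, computes P (delete_bit n x) n (nat_of_bool (x n)).

(** A prediction of every bit from the others cannot be forced to be correct by
    finitely many bits, because changing a later bit does not change its prediction. *)
Lemma meager_autoreduces P : meager (fun z => autoreduces P (spread z)).
Proof.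
have [W [lt om]] := omega1_ex.
have /choice[g hg] j := generic_evaluation om P j.*2 (@decided_delete_spread j.*2).
pose predicted z := forall j, g j (delete_bit j.*2 (spread z)) = z j.
have mpred : meager predicted.
  apply: nowhere_forced_meager.
    apply: decided_all => j.
    apply: (@decided_bind _ (fun z => z j) (fun b z => g j (delete_bit j.*2 (spread z)) = b)).
      by move=> b; apply: decided_bit.
    by move=> b; case: (hg j).
  move=> s hs; pose j := size s.
  have [x [sx good]] := baire_cylinder s (meagerU hs (meager_flip j hs)).
  have sfx : cylinder s (flip j x).
    by move=> i is_; rewrite /flip (ltn_eqF is_) sx.
  have px : predicted x by apply: contrapT => n; apply: good; left.
  have pfx : predicted (flip j x) by apply: contrapT => n; apply: good; right.
  have := pfx j; rewrite delete_spread_flip (px j) /flip eqxx.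
  by case: (x j).
have mbad := meager_ex (fun j => (hg j).2).
apply: sub_meager (meagerU mpred mbad) => z hz.
have [|np] := EM (predicted z); [by left|right].
have /existsNP[j hj] := np; exists j, (z j); split=> //.
by have := hz j.*2; rewrite spread_double.
Qed.

(** The codes make the programs countable in spite of the dependence of the type of
    instructions on the number of registers. *)
Definition instr_code k (I : instr k) : nat * (nat * (nat * nat)) :=
  match I with
  | Zero i => (0, (val i, (0, 0)))
  | Succ i => (1, (val i, (0, 0)))
  | Copy i j => (2, (val i, (val j, 0)))
  | JumpEq i j q => (3, (val i, (val j, q)))
  | Oracle i => (4, (val i, (0, 0)))
  end.

Definition instr_decode k (c : nat * (nat * (nat * nat))) : instr k :=
  let: (tag, (i, (j, q))) := c in
  match tag with
  | 0 => Zero (inord i)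
  | 1 => Succ (inord i)
  | 2 => Copy (inord i) (inord j)
  | 3 => JumpEq (inord i) (inord j) q
  | _ => Oracle (inord i)
  end.

Lemma instr_codeK k : cancel (@instr_code k) (@instr_decode k).
Proof. by case=> * /=; rewrite !inord_val. Qed.

Definition program_decode (c : nat * seq (nat * (nat * (nat * nat)))) : program :=
  Program (map (@instr_decode c.1) c.2).

Lemma program_decode_surj P : exists c, program_decode c = P.
Proof.
case: P => k l; exists (k, map (@instr_code k) l).
by rewrite /program_decode /= (mapK (@instr_codeK k)).
Qed.

Theorem theorem9 (R : realType) :
  exists x : nat -> bool, IC_ITRM x /\ ~ RA_ITRM R x.
Proof.
have [z [_ hz]] := baire_cylinder [::]
  (meager_ex (fun c => meager_autoreduces (program_decode c))).
exists (spread z); split.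
  move=> [P hP]; apply: hz; have [c cP] := program_decode_surj P.
  by exists c; rewrite cP.
apply; exists even_supported; split.
- exact: even_supported_decidable.
- exact: even_supported_null.
- exact: spread_even.
Qed.
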